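(* Let $\mathcal{A}=(A_n)$ be a van Hove sequence on $G$ and let $\varLambda\subseteq G$ be a Delone set. Then the Dirac comb $\delta_\varLambda$ is mean almost periodic with respect to $\mathcal{A}$ if and only if, for each open neighbourhood $U\subseteq G$ of $0$ and each $\varepsilon>0$, the set $$\Big\{t\in G\,:\,\limsup_{n\to\infty}\frac{\operatorname{card}\big((\varLambda\,\triangle_U\,(t+\varLambda))\cap A_n\big)}{|A_n|}<\varepsilon\Big\}$$ is relatively dense.
   Context: $G$ is a locally compact (Hausdorff), $\sigma$-compact abelian group with Haar measure $\theta_G$; $|A|=\theta_G(A)$, and $\mathrm{d}t$ denotes integration against $\theta_G$. $(\tau_tf)(s)=f(s-t)$. For a measure $\mu$ and $\varphi\in C_c(G)$, $(\mu*\varphi)(t)=\int_G\varphi(t-s)\,\mathrm{d}\mu(s)$. A set $P\subseteq G$ is relatively dense if $P+K=G$ for some compact $K$. A set $\varLambda$ is uniformly discrete if there is an open neighbourhood $V$ of $0$ with $(s+V)\cap(t+V)=\varnothing$ for all distinct $s,t\in\varLambda$. A Delone set is a relatively dense and uniformly discrete set. $\delta_\varLambda=\sum_{x\in\varLambda}\delta_x$ is its Dirac comb (a translation bounded measure). For Delone sets $\varLambda,\varGamma$ and an open neighbourhood $U$ of $0$, $\varLambda\,\triangle_U\,\varGamma=\big(\varLambda\setminus(\varGamma+U)\big)\cup\big(\varGamma\setminus(\varLambda+U)\big)$. A van Hove sequence $\mathcal{A}=(A_n)$ is a sequence of relatively compact open sets (of positive measure) with $|\partial^K A_n|/|A_n|\to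 0$ for every compact $K\subseteq G$, where $\partial^K A=\big(\overline{A+K}\cap\overline{A^c}\big)\cup\big(\overline{A^c-K}\cap\overline{A}\big)$. For locally integrable $f$ put $\|f\|_{\mathsf{B},1,\mathcal{A}}=\limsup_{n}\frac{1}{|A_n|}\int_{A_n}|f(t)|\,\mathrm{d}t$. A translation bounded measure $\mu$ is mean almost periodic with respect to $\mathcal{A}$ if for every $\varphi\in C_c(G)$ and every $\varepsilon>0$ the set $\{t\in G:\|\mu*\varphi-\tau_t(\mu*\varphi)\|_{\mathsf{B},1,\mathcal{A}}<\varepsilon\}$ is relatively dense. *)

(* Defs.v *)
From HB Require Import structures.
From mathcomp Require Import all_boot all_order all_algebra.
From mathcomp Require Import complex.
From mathcomp Require Import all_classical all_reals all_analysis.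

Set Implicit Arguments.
Unset Strict Implicit.
Unset Printing Implicit Defensive.

Import Order.TTheory GRing.Theory Num.Theory.
Import numFieldNormedType.Exports.

Local Open Scope classical_set_scope.
Local Open Scope ring_scope.

(* The group G with its Borel sigma-algebra. An alias of G is needed because
   [g_sigma_algebraType] expects a pointed type, and a topologicalZmodType is
   not canonically pointed. *)
Definition borel (G : topologicalZmodType) : Type := G.

Section borel_measurable.
Variable G : topologicalZmodType.

HB.instance Definition _ := Choice.on (borel G).
HB.instance Definition _ := isPointed.Build (borel G) (0 : G).
HB.instance Definition _ := @isMeasurable.Build (sigma_display (@open G))
  (borel G) <<s @open G >> (@sigma_algebra0 _ setT (@open G))
  (@sigma_algebraC (borel G) (@open G))
  (@sigma_algebra_bigcup _ setT (@open G)).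

End borel_measurable.

Section sets.
Variable G : topologicalZmodType.
Implicit Types (A B K P U L M : set G) (t : G).

Definition minkowski_add A B : set G := [set x + y | x in A & y in B].
Definition minkowski_sub A B : set G := [set x - y | x in A & y in B].
Definition translate t A : set G := [set t + x | x in A].

Definition sigma_compact : Prop :=
  exists2 K : nat -> set G, (forall n, compact (K n)) & \bigcup_n K n = setT.

Definition relatively_dense P : Prop :=
  exists2 K, compact K & minkowski_add P K = setT.

Definition uniformly_discrete L : Prop :=
  exists V : set G, [/\ open V, V 0 &
    forall s t, L s -> L t -> s <> t -> translate s V `&` translate t V = set0].

Definition delone L : Prop := relatively_dense L /\ uniformly_discrete L.

(* L \triangle_U M *)
Definition symdiff U L M : set G :=
  (L `\` minkowski_add M U) `|` (M `\` minkowski_add L U).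

(* \partial^K A *)
Definition boundary K A : set G :=
  (closure (minkowski_add A K) `&` closure (~` A)) `|`
  (closure (minkowski_sub (~` A) K) `&` closure A).

End sets.
Arguments sigma_compact : clear implicits.

Section measures.
Variables (R : realType) (G : topologicalZmodType).
Implicit Types (theta mu : {measure set (borel G) -> \bar R}).
Local Open Scope ereal_scope.

(* On a non-second-countable G, regularity does not follow from local
   finiteness, hence the last two fields. *)
Record haar_measure theta : Prop := {
  haar_neq0 : theta setT != 0 ;
  haar_invariant : forall (t : G) (B : set G),
    measurable (B : set (borel G)) -> theta (translate t B) = theta B ;
  haar_compact : forall K : set G, compact K -> theta K < +oo ;
  haar_outer : forall B : set G, measurable (B : set (borel G)) ->
    theta B = ereal_inf [set theta U | U in [set U : set G | open U /\ B `<=` U]] ;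
  haar_inner : forall U : set G, open U ->
    theta U = ereal_sup [set theta K | K in [set K : set G | compact K /\ K `<=` U]]
}.

Record van_hove theta (A : nat -> set G) : Prop := {
  van_hove_open : forall n, open (A n) ;
  van_hove_precompact : forall n, precompact (A n) ;
  van_hove_gt0 : forall n, 0 < theta (A n) ;
  van_hove_boundary : forall K : set G, compact K ->
    theta (boundary K (A n)) / theta (A n) @[n --> \oo] --> 0
}.

Definition besicovitch_seminorm theta (A : nat -> set G) (f : G -> R[i]) :=
  limn_esup (fun n => (\int[theta]_(t in A n) (ComplexField.Normc.normc (f t))%:E)
                      / theta (A n)).

(* phi \in C_c(G) *)
Definition continuous_csupp (phi : G -> R[i]) : Prop :=
  continuous (phi : G -> R[i]^o) /\ compact (closure [set x | phi x != 0%R]).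

(* The complex-valued integral is taken componentwise; only positive measures
   mu are needed, as the measure of interest is a Dirac comb. *)
Definition convolution mu (phi : G -> R[i]) (t : G) : R[i] :=
  Complex (\int[mu]_s complex.Re (phi (t - s)))%R
          (\int[mu]_s complex.Im (phi (t - s)))%R.

Definition translation_bounded mu : Prop :=
  forall K : set G, compact K ->
    ereal_sup [set mu (translate t K) | t in [set: G]] < +oo.

(* Mean almost periodicity is a notion for translation bounded measures, hence
   the first conjunct, which holds for the Dirac comb of any Delone set. *)
Definition mean_almost_periodic theta (A : nat -> set G) mu : Prop :=
  translation_bounded mu /\
  forall phi : G -> R[i], continuous_csupp phi ->
  forall e : R, (0 < e)%R ->
    relatively_dense [set t : G |
      besicovitch_seminorm theta A
        (fun s => convolution mu phi s - convolution mu phi (s - t))%R < e%:E].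

Definition dirac_comb (L : set G) (B : set (borel G)) : \bar R :=
  \esum_(x in L) \d_(x : borel G) B.

Section dirac_comb_measure.
Variable L : set G.

Let dirac_comb0 : dirac_comb L set0 = 0.
Proof. by apply: esum1 => x _; rewrite measure0. Qed.

Let dirac_comb_ge0 B : 0 <= dirac_comb L B.
Proof. by apply: esum_ge0 => x _; exact: measure_ge0. Qed.

Let dirac_comb_sigma_additive : semi_sigma_additive (dirac_comb L).
Proof.
move=> F mF tF mUF.
suff <- : \sum_(n <oo) dirac_comb L (F n) = dirac_comb L (\bigcup_n F n).
  by apply: is_cvg_nneseries => n _ _; exact: dirac_comb_ge0.
rewrite nneseries_esumT; last by move=> n; exact: dirac_comb_ge0.
rewrite /dirac_comb esum_esum; last by move=> *; exact: measure_ge0.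
rewrite (@reindex_esum _ _ _ (L `*` [set: nat]) _ (fun p => (p.2, p.1))).
- rewrite -(@esum_esum _ _ _ L (fun=> [set: nat])
    (fun x n => \d_(x : borel G) (F n))); last by move=> *; exact: measure_ge0.
  apply: eq_esum => x _; rewrite measure_bigcup//.
  rewrite -nneseries_esumT; last by move=> n; exact: measure_ge0.
  by apply: eq_eseriesl => n; rewrite in_setT.
- split=> [[x n] [? _] //|[x n] [y m] _ _ [-> ->] //|[n x] [_ Lx]].
  by exists (x, n).
Qed.

HB.instance Definition _ := isMeasure.Build _ _ _ (dirac_comb L)
  dirac_comb0 dirac_comb_ge0 dirac_comb_sigma_additive.

End dirac_comb_measure.

End measures.
Arguments dirac_comb {R G} L B.

(* Main.v *)
Require Import Defs.
From HB Require Import structures.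
From mathcomp Require Import all_boot all_order all_algebra ring lra finmap.
From mathcomp Require Import complex.
From mathcomp Require Import all_classical all_reals all_analysis.
From mathcomp Require Import measurable_realfun.

Set Implicit Arguments.
Unset Strict Implicit.
Unset Printing Implicit Defensive.

Import Order.TTheory GRing.Theory Num.Theory.
Import numFieldNormedType.Exports.

Local Open Scope classical_set_scope.
Local Open Scope ring_scope.

(* Write S for the U-symmetric difference of L and t + L.  If phi >= 0 is a bump
   function supported near 0, then delta_L * phi and its translate by t differ by
   at least 1 on W + S, where W = {phi > 1}; the translates z + W (z in S) are
   disjoint, so card (S `&` A n) |W| is at most the integral of the difference
   over A n plus |W + (S `&` A n) \ A n|, which is a boundary term.  Conversely,
   when U is small the points of L within U of t + L are matched bijectively with
   those of t + L within U of L, and matched points contribute to the difference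
   at most a uniform-continuity error; the points of S contribute at most
   sup |phi| |supp phi| each if they lie in A n, and a boundary term otherwise. *)

(** * Topological groups: sumsets, small neighbourhoods, disjoint translates *)

Section topological_group.
Variable G : topologicalZmodType.
Implicit Types (A B K U V W L M : set G) (s t x y : G).

Lemma translateE t A x : translate t A x = A (x - t).
Proof.
apply/propext; split => [[y Ay <-]|Axt]; first by rewrite addrC addKr.
by exists (x - t) => //; rewrite addrC subrK.
Qed.

Lemma minkowski_addE A B x :
  minkowski_add A B x <-> exists2 y, A y & B (x - y).
Proof.
split => [[y Ay [z Bz <-]]|[y Ay Bxy]]; first by exists y => //; rewrite addrC addKr.
by exists y => //; exists (x - y) => //; rewrite addrC subrK.
Qed.

Lemma minkowski_add_bigcup A B : minkowski_add A B = \bigcup_(x in A) translate x B.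
Proof.
apply/seteqP; split=> z.
  by move=> /minkowski_addE[x Ax Bzx]; exists x => //; rewrite translateE.
by move=> [x Ax]; rewrite translateE => Bzx; apply/minkowski_addE; exists x.
Qed.

Lemma addr_continuous t : continuous (fun x => x + t).
Proof.
move=> x.
apply: (@continuous2_cvg _ _ _ _ _ _ id (cst t) (fun x y => x + y) x t) => //.
- exact: (@add_continuous G (x, t)).
- exact: cvg_cst.
Qed.

Lemma subl_continuous t : continuous (fun x => t - x).
Proof.
move=> x.
apply: (@continuous2_cvg _ _ _ _ _ _ (cst t) id (fun x y => x - y) t x) => //.
- exact: (@sub_continuous G (t, x)).
- exact: cvg_cst.
Qed.

Lemma open_translate t U : open U -> open (translate t U).
Proof.
move=> oU; rewrite (_ : translate t U = (fun x => x + (- t)) @^-1` U); last first.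
  by apply/funext => x; rewrite translateE.
by apply: open_comp => // x _; exact: addr_continuous.
Qed.

Lemma open_minkowski_addr A U : open U -> open (minkowski_add A U).
Proof.
move=> oU; rewrite minkowski_add_bigcup.
by apply: bigcup_open => x _; exact: open_translate.
Qed.

Lemma compact_minkowski_add K L :
  compact K -> compact L -> compact (minkowski_add K L).
Proof.
move=> cK cL.
rewrite (_ : minkowski_add K L = (fun p : G * G => p.1 + p.2) @` (K `*` L)).
  apply: continuous_compact; last exact: compact_setX.
  by apply: continuous_subspaceT; exact: add_continuous.
apply/seteqP; split=> [z [x Kx [y Ly <-]]|z [[x y] [/= Kx Ly] <-]].
  by exists (x, y).
by exists x => //; exists y.
Qed.

Lemma compact_subl t K : compact K -> compact [set t - x | x in K].
Proof.
move=> cK; apply: continuous_compact => //.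
by apply: continuous_subspaceT; exact: subl_continuous.
Qed.

Lemma compact_translate t K : compact K -> compact (translate t K).
Proof.
move=> cK; apply: continuous_compact => //; apply: continuous_subspaceT => x.
rewrite (_ : (fun x => t + x) = (fun x => x + t)).
  exact: addr_continuous.
by apply/funext => ?; exact: addrC.
Qed.

Lemma nbhs0_sub U : nbhs 0 U ->
  exists W, [/\ open W, W 0 & forall x y, W x -> W y -> U (x - y)].
Proof.
move=> U0; have := @sub_continuous G (0, 0) U; rewrite /= subr0 => /(_ U0).
move=> [[A B] /= [A0 B0] AB].
exists (interior (A `&` B)); split.
- exact: open_interior.
- by rewrite /interior; exact: filterI.
- move=> x y /interior_subset [Ax _] /interior_subset [_ By].
  exact: (AB (x, y)).
Qed.

Lemma nbhs0_sym U : nbhs 0 U -> exists W,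
  [/\ open W, W 0, W `<=` U & forall x, W x -> W (- x)].
Proof.
move=> U0; have [W [oW W0 WU]] := nbhs0_sub U0.
exists (W `&` [set - x | x in W]); split.
- apply: openI => //; rewrite (_ : [set - x | x in W] = (fun x => 0 - x) @^-1` W).
    by apply: open_comp => // x _; exact: subl_continuous.
  apply/seteqP; split=> [x [y Wy <-]|x]; rewrite /= sub0r ?opprK//.
  by move=> Wx; exists (- x) => //; rewrite opprK.
- by split => //; exists 0; rewrite ?oppr0.
- by move=> x [Wx _]; have := WU x 0 Wx W0; rewrite subr0.
- move=> x [Wx [y Wy yx]]; split; first by rewrite -yx opprK.
  by exists x.
Qed.

Lemma relatively_denseS A B : A `<=` B -> relatively_dense A -> relatively_dense B.
Proof.
move=> AB [K cK AK]; exists K => //; rewrite -subTset -AK.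
by move=> _ [x Ax [y Ky <-]]; exists x; [exact: AB|exists y].
Qed.

Lemma compact_nbhs0 : locally_compact [set: G] ->
  exists2 C, compact C & nbhs (0 : G) C.
Proof.
move=> /(_ 0 Logic.I); rewrite withinET.
by move=> [C C0 [cC _]]; exists C.
Qed.

(** Uniform discreteness with the neighbourhood made explicit: one [W] can then serve [L] and all
    its translates, and counting bounds can be uniform in [L]. In the [trivIset] form, two
    translates that meet have the same index. *)
Definition disjoint_translates W L := trivIset L (fun x => translate x W).

Lemma disjoint_translatesS W V L : W `<=` V ->
  disjoint_translates V L -> disjoint_translates W L.
Proof.
move=> WV sL x y Lx Ly [z []]; rewrite !translateE => /WV Vx /WV Vy.
by apply: sL => //; exists z; split; rewrite translateE.
Qed.

Lemma disjoint_translates_sub W L M : L `<=` M ->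
  disjoint_translates W M -> disjoint_translates W L.
Proof. by move=> LM sM x y /LM Mx /LM My; exact: sM. Qed.

Lemma disjoint_translates_translate W t L :
  disjoint_translates W L -> disjoint_translates W (translate t L).
Proof.
move=> sL x y; rewrite !translateE => Lx Ly [z []]; rewrite !translateE => Wx Wy.
apply: (@addIr _ (- t)); apply: sL => //; exists (z - t); split;
  by rewrite translateE opprB addrA subrK.
Qed.

Lemma uniformly_discreteP L : uniformly_discrete L ->
  exists V, [/\ open V, V 0 & disjoint_translates V L].
Proof.
move=> [V [oV V0 dV]]; exists V; split => // x y Lx Ly [z xyz].
by apply: contrapT => /(dV x y Lx Ly) xy0; rewrite xy0 in xyz.
Qed.

(** Stated for translates of compact sets because the terms of a convolution at [s] live on
    [s - K]. *)
Definition locally_finite L :=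
  forall K, compact K -> forall t, finite_set (L `&` translate t K).

Lemma locally_finite_translate t L :
  locally_finite L -> locally_finite (translate t L).
Proof.
move=> fL K cK s.
rewrite (_ : _ `&` _ = (fun x => t + x) @` (L `&` translate (s - t) K)).
  by apply: finite_image; exact: fL.
apply/seteqP; split=> [_ [[x Lx <-]]|_ [x [Lx]] + <-]; rewrite translateE => Kx.
  by exists x => //; split => //; rewrite translateE opprB addrCA addrA.
by split; [exists x|rewrite translateE; rewrite opprB addrCA addrA in Kx].
Qed.

Lemma closed_boundary K A : closed (boundary K A).
Proof. by apply: closedU; apply: closedI; exact: closed_closure. Qed.

End topological_group.

Lemma notin_closure_support (T : topologicalType) (V : nmodType) (f : T -> V) x :
  ~ closure [set y | f y != 0] x -> f x = 0.
Proof.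
by move=> nx; apply/eqP/negPn/negP => /(@subset_closure _ [set y | f y != 0])/nx.
Qed.

(** * Compactness by finite subcovers *)

Section compact_cover_group.
Variable G : topologicalZmodType.

(* [compact_cover] is stated for pointed spaces, which [borel G] is. *)
#[local] HB.instance Definition _ := Topological.copy (borel G) G.

Lemma compact_group_cover (K : set G) : compact K -> cover_compact K.
Proof. by rewrite (_ : compact K = @compact (borel G) K)// compact_cover. Qed.

End compact_cover_group.

(** * Haar measure: positivity on open sets and packing bounds *)

Section haar.
Variables (R : realType) (G : topologicalZmodType).
Implicit Types (A B K U V W L M S : set G) (s t x y : G).
Local Open Scope ereal_scope.

Lemma open_borel U : open U -> measurable (U : set (borel G)).
Proof. by move=> oU; exact: sub_sigma_algebra. Qed.

Lemma closed_borel U : closed U -> measurable (U : set (borel G)).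
Proof.
by move=> cU; rewrite -(setCK U); apply: measurableC; apply: open_borel;
  rewrite openC.
Qed.

Lemma compact_borel K : hausdorff_space G -> compact K ->
  measurable (K : set (borel G)).
Proof. by move=> hG cK; apply: closed_borel; exact: compact_closed. Qed.

(** [counting] is infinite on infinite sets, so any real bound on it doubles as a proof of
    finiteness. *)
Lemma counting_fin S (c : R) : counting S <= c%:E -> finite_set S.
Proof. by rewrite /counting; case: asboolP. Qed.

Lemma counting_fset S : finite_set S ->
  counting S = ((#|` fset_set S |)%:R%:E : \bar R).
Proof. by rewrite /counting => fS; rewrite asboolT. Qed.

Variable theta : {measure set (borel G) -> \bar R}.
Hypothesis haar : haar_measure theta.

Lemma haar_le A B : measurable (A : set (borel G)) ->
  measurable (B : set (borel G)) -> A `<=` B -> theta A <= theta B.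
Proof. by move=> mA mB AB; apply: le_measure; rewrite ?inE. Qed.

(** Finitely many translates of [U] cover [K], and each of them is null by invariance. *)
Lemma haar_compact_null U : open U -> U 0%R -> theta U = 0 ->
  forall K, hausdorff_space G -> compact K -> theta K = 0.
Proof.
move=> oU U0 tU0 K hG cK; apply/eqP; rewrite eq_le measure_ge0 andbT.
have /(_ G setT (fun x => translate x U)) [] := compact_group_cover cK.
- by move=> x _; exact: open_translate.
- by move=> x _; exists x => //; rewrite translateE subrr.
move=> D _ KD.
have mD (s : seq G) :
    measurable (\big[setU/set0]_(x <- s) translate x U : set (borel G)).
  by apply: bigsetU_measurable => x _; apply: open_borel; exact: open_translate.
apply: (@le_trans _ _ (theta (\big[setU/set0]_(x <- D) translate x U))).
  apply: haar_le => //; first exact: compact_borel.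
  by move=> x /KD; rewrite /cover -bigcup_fset.
elim: (D : seq G) => [|x s ih]; first by rewrite big_nil measure0.
have mxU : measurable (translate x U : set (borel G)).
  by apply: open_borel; exact: open_translate.
have txU : theta (translate x U) <= 0.
  by rewrite (haar_invariant haar) ?tU0//; exact: open_borel.
rewrite big_cons (le_trans (measureU2 _ _ _))//.
by rewrite -(adde0 0); apply: leeD.
Qed.

(** A null neighbourhood of 0 would make every compact set null, hence by inner regularity the whole
    group, against [haar_neq0]. *)
Lemma haar_open_gt0 U : hausdorff_space G -> open U -> U 0%R -> 0 < theta U.
Proof.
move=> hG oU U0; rewrite lt_neqAle measure_ge0 andbT eq_sym.
apply: contra (haar_neq0 haar) => /eqP tU0.
rewrite (haar_inner haar openT) eq_le; apply/andP; split.
  by apply: ge_ereal_sup => _ [K [cK _] <-]; rewrite (haar_compact_null oU).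
apply: ereal_sup_ubound; exists set0; last by rewrite measure0.
by split => //; exact: compact0.
Qed.

Lemma haar_packing_fset W (X : {fset G}) : open W -> disjoint_translates W [set` X] ->
  theta (minkowski_add [set` X] W) = (#|` X |)%:R%:E * theta W.
Proof.
move=> oW sX; rewrite minkowski_add_bigcup measure_fin_bigcup//; last first.
  by move=> x _; apply: open_borel; exact: open_translate.
rewrite fsbig_finite// set_fsetK (eq_bigr (fun=> theta W)); last first.
  by move=> x _; apply: (haar_invariant haar); exact: open_borel.
by rewrite big_const_seq count_predT iter_addr_0 mule_natl.
Qed.

(** Additivity over the disjoint translates gives the bound for each finite subset of [S]. When [S]
    is infinite, these bounds force [theta B] to be infinite. *)
Lemma haar_packing W S B : open W -> 0 < theta W -> disjoint_translates W S ->
  measurable (B : set (borel G)) -> minkowski_add S W `<=` B ->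
  counting S * theta W <= theta B.
Proof.
move=> oW W0 sS mB SWB.
have le_fset (X : {fset G}) : [set` X] `<=` S -> (#|` X |)%:R%:E * theta W <= theta B.
  move=> XS; rewrite -haar_packing_fset//; last exact: disjoint_translates_sub sS.
  apply: haar_le => //; first by apply: open_borel; exact: open_minkowski_addr.
  by apply: subset_trans SWB => _ [x Xx [w Ww <-]]; exists x; [exact: XS|exists w].
have [fS|iS] := pselect (finite_set S).
  by rewrite counting_fset// le_fset// fset_setK.
have -> : theta B = +oo; last exact: leey.
apply/eqyP => r r0.
(* If [theta W] is infinite, one translate already exceeds [r]; if it is finite, more than
   [r / theta W] translates are taken. *)
have [wfin|] := boolP (theta W \is a fin_num); last first.
  rewrite ge0_fin_numE ?measure_ge0// -leNgt leye_eq => /eqP Woo.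
  have [X XS X1] := infinite_set_fset 1 iS.
  have := le_fset X XS; rewrite Woo gt0_muley ?leye_eq ?lte_fin ?ltr0n// => /eqP ->.
  exact: leey.
have w0 : (0 < fine (theta W))%R by rewrite -lte_fin fineK.
have [X XS Xn] := infinite_set_fset (Num.bound (r / fine (theta W))) iS.
apply: le_trans (le_fset X XS); rewrite -(fineK wfin) -EFinM lee_fin -ler_pdivrMr//.
apply: le_trans (ltW (archi_boundP _)) _; first by rewrite divr_ge0// ltW.
by rewrite ler_nat.
Qed.

(** The points of [L] in [t + K] carry disjoint translates of a small [V], all inside [t + (K + C)].
    Invariance makes the resulting bound [|K + C| / |V|] independent of [t] and of [L]. *)
Lemma disjoint_translates_count_bound W K : hausdorff_space G ->
    locally_compact [set: G] -> open W -> W 0%R -> compact K ->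
  exists2 c : R, (0 <= c)%R & forall L t, disjoint_translates W L ->
    counting (L `&` translate t K) <= c%:E.
Proof.
move=> hG lG oW W0 cK; have [C cC C0] := compact_nbhs0 lG.
(* Cutting [W] down to the compact [C] makes its measure finite, so that the division is
   legitimate. *)
pose V := W `&` interior C.
have oV : open V by apply: openI => //; exact: open_interior.
have V0 : V 0%R by split.
have tV0 : 0 < theta V by exact: haar_open_gt0.
have cKC : compact (minkowski_add K C) by exact: compact_minkowski_add.
have tVfin : theta V \is a fin_num.
  rewrite ge0_fin_numE ?measure_ge0// (le_lt_trans _ (haar_compact haar cC))//.
  apply: haar_le; [exact: open_borel|exact: compact_borel|].
  by move=> x [_ /interior_subset].
have tKCfin : theta (minkowski_add K C) \is a fin_num.
  by rewrite ge0_fin_numE ?measure_ge0// haar_compact.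
have v0 : (0 < fine (theta V))%R by rewrite -lte_fin fineK.
exists (fine (theta (minkowski_add K C)) / fine (theta V))%R.
  by rewrite divr_ge0 ?fine_ge0 ?measure_ge0.
move=> L t sL.
rewrite EFinM lee_pdivlMr// !fineK//.
rewrite -(haar_invariant haar t (compact_borel hG cKC)).
apply: haar_packing => //.
- exact: (disjoint_translates_sub (@subIsetl _ _ _)
    (disjoint_translatesS (@subIsetl _ _ _) sL)).
- by apply: compact_borel => //; exact: compact_translate.
move=> _ [x [_ [k Kk <-]] [v [_ /interior_subset Cv] <-]].
by exists (k + v)%R; [exists k => //; exists v|rewrite addrA].
Qed.

Lemma disjoint_translates_locally_finite W L : hausdorff_space G ->
    locally_compact [set: G] -> open W -> W 0%R -> disjoint_translates W L ->
  locally_finite L.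
Proof.
move=> hG lG oW W0 dL K cK t.
have [c _ cP] := disjoint_translates_count_bound hG lG oW W0 cK.
exact: counting_fin (cP L t dL).
Qed.

End haar.

(** * Integration against a Dirac comb *)

Section dirac_comb.
Variables (R : realType) (G : topologicalZmodType).
Implicit Types (L D : set G).
Local Open Scope ereal_scope.

Lemma dirac_combE L D (B : set (borel G)) : finite_set (L `&` D) -> B `<=` D ->
  dirac_comb L B = \sum_(x <- fset_set (L `&` D)) \d_(x : borel G) B :> \bar R.
Proof.
move=> fLD BD; rewrite /dirac_comb.
rewrite (@eq_esum _ _ _ _ (fun x : G => if x \in D then \d_(x : borel G) B else 0)).
  by rewrite -esum_mkcondr esum_fset// fsbig_finite.
move=> x _; case: ifPn => // /negP xD; rewrite diracE memNset//.
by move=> /BD Dx; apply: xD; rewrite inE.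
Qed.

Lemma dirac_comb_counting L D : finite_set (L `&` D) ->
  dirac_comb L D = counting (L `&` D) :> \bar R.
Proof.
move=> fLD; rewrite (dirac_combE fLD)// counting_fset//.
rewrite big_seq (eq_bigr (fun=> 1%:E)); last first.
  by move=> x; rewrite in_fset_set// inE => -[_ Dx]; rewrite diracE mem_set.
by rewrite -big_seq sumEFin big_const_seq count_predT iter_addr_0.
Qed.

(** On subsets of [D] the comb agrees with a finite sum of point masses, and integration is additive
    in the measure. *)
Lemma ge0_integral_dirac_comb L (D : set (borel G)) (f : borel G -> \bar R) :
    measurable D -> finite_set (L `&` D) -> measurable_fun setT f ->
    (forall x, 0 <= f x) -> (forall x, ~ D x -> f x = 0) ->
  \int[dirac_comb L]_x f x = \sum_(x <- fset_set (L `&` D)) f x.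
Proof.
move=> mD fLD mf f0 fD; set X := fset_set _.
transitivity (\int[dirac_comb L]_(x in D) f x).
  rewrite [RHS]integral_mkcond; apply: eq_integral => x _.
  by rewrite /patch; case: ifPn => // /negP; rewrite inE; exact: fD.
(* The default 0 of [nth] is never reached: [msum m (size X)] only uses indices below [size X]. *)
pose m (n : nat) : {measure set (borel G) -> \bar R} :=
  [the measure _ _ of \d_(nth 0%R X n : borel G)].
rewrite (@eq_measure_integral _ _ _ _ (msum m (size X))); last first.
  move=> A mA AD; rewrite [LHS](dirac_combE fLD AD) /msum -/X.
  by rewrite (big_nth (0%R : G)) big_mkord.
have mfD : measurable_fun D f by exact: measurable_funTS.
rewrite ge0_integral_measure_sum// (big_nth (0%R : G)) big_mkord.
apply: eq_bigr => i _; rewrite integral_dirac// diracE mem_set ?mul1e//.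
have : nth (0%R : G) X i \in X by exact: mem_nth.
by rewrite in_fset_set// inE => -[].
Qed.

(** The positive and negative parts fall under the nonnegative case, and their finite sums recombine
    termwise. *)
Lemma Rintegral_dirac_comb L (D : set G) (g : G -> R) :
    measurable (D : set (borel G)) -> finite_set (L `&` D) ->
    measurable_fun setT (g : borel G -> R) ->
    (forall x, ~ D x -> g x = 0%R) ->
  (\int[dirac_comb L]_s g s = \sum_(s \in L) g s)%R.
Proof.
move=> mD fLD mg gD.
rewrite -(@fsbig_widen _ _ _ _ (L `&` D) L)//; last first.
  by move=> x [Lx /= nLDx]; apply: gD => Dx; exact: nLDx.
rewrite fsbig_finite// /Rintegral integralE.
have mge : measurable_fun setT (EFin \o g : borel G -> \bar R).
  exact/measurable_EFinP.
rewrite !(@ge0_integral_dirac_comb L D)//.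
- rewrite (eq_bigr (fun x => (Num.max (g x) 0)%:E)); last first.
    by move=> x _; rewrite funeposE/= -EFin_max.
  rewrite [X in (_ - X)%E](eq_bigr (fun x => (Num.max (- g x) 0)%:E)); last first.
    by move=> x _; rewrite funenegE/= -EFin_max.
  rewrite !sumEFin -EFinB/= -sumrB; apply: eq_bigr => x _.
  have [gx|/ltW gx] := leP 0%R (g x).
    by rewrite max_r ?oppr_le0// subr0.
  by rewrite max_l ?oppr_ge0// sub0r opprK.
- exact: (measurable_funeneg mge).
- by move=> x /gD gx; rewrite funenegE /= gx oppr0 maxxx.
- exact: (measurable_funepos mge).
- by move=> x /gD gx; rewrite funeposE /= gx maxxx.
Qed.

End dirac_comb.

(** * Norm and continuity of real and imaginary parts *)

Section complex_norm.
Variable R : realType.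
Import ComplexField.Normc.

Lemma ler_norm_normc (a b : R) : `|a| <= normc (Complex a b).
Proof. by rewrite /normc -sqrtr_sqr ler_wsqrtr// lerDl sqr_ge0. Qed.

Lemma ler_normi_normc (a b : R) : `|b| <= normc (Complex a b).
Proof. by rewrite /normc -sqrtr_sqr ler_wsqrtr// lerDr sqr_ge0. Qed.

Lemma normc_ler_norm (a b : R) : normc (Complex a b) <= `|a| + `|b|.
Proof.
rewrite /normc -[leRHS]ger0_norm ?addr_ge0// -sqrtr_sqr ler_wsqrtr//.
rewrite sqrrD !real_normK ?num_real// -addrA lerD2l lerDr.
by rewrite mulrn_wge0// mulr_ge0.
Qed.

Lemma complex_Re_continuous : continuous (@complex.Re R : R[i]^o -> R).
Proof.
move=> z A /nbhs_ballP[e e0 eA]; apply/nbhs_ballP; exists e%:C%C => /=.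
  by rewrite ltcR.
move=> y; rewrite -ball_normE /ball_ /= => zy; apply: eA; rewrite -ball_normE /=.
move: zy; case: z => a b; case: y => c d /=.
by rewrite ltcR; apply: le_lt_trans; exact: ler_norm_normc.
Qed.

Lemma complex_Im_continuous : continuous (@complex.Im R : R[i]^o -> R).
Proof.
move=> z A /nbhs_ballP[e e0 eA]; apply/nbhs_ballP; exists e%:C%C => /=.
  by rewrite ltcR.
move=> y; rewrite -ball_normE /ball_ /= => zy; apply: eA; rewrite -ball_normE /=.
move: zy; case: z => a b; case: y => c d /=.
rewrite ltcR; apply: le_lt_trans.
exact: (ler_normi_normc (a - c)).
Qed.

Lemma real_complex_continuous : continuous (real_complex R : R -> R[i]^o).
Proof.
(* A positive element of [R[i]] has imaginary part 0, so the radius of the complex ball is the real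
   number [e]. *)
move=> x A /nbhs_ballP[[e e'] /=]; rewrite ltcE /= => /andP[/eqP -> e0] eA.
apply/nbhs_ballP; exists e => //= y; rewrite -ball_normE /= => xy; apply: eA.
rewrite -ball_normE /ball_ /= -rmorphB /= ltcE/= eqxx/=.
by rewrite expr0n addr0 sqrtr_sqr.
Qed.

End complex_norm.

(** * Continuous functions with compact support *)

Section continuous_compact_support.
Variables (R : realType) (G : topologicalZmodType).
Implicit Types (psi : G -> R) (K U : set G).

Lemma continuous_borel psi :
  continuous psi -> measurable_fun setT (psi : borel G -> R).
Proof.
move=> /continuousP cpsi; apply: (measurability _ (RGenOpens.measurableE R)).
move=> _ [_ [a [b ->] <-]]; rewrite setTI; apply: open_borel.
exact/cpsi/interval_open.
Qed.

(** Near each [x] in [K] the values are at most [|psi x| + 1] in absolute value; the near-covering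
    form of compactness turns these local bounds into a single one. *)
Lemma csupp_bounded psi K : continuous psi -> compact K ->
  (forall x, ~ K x -> psi x = 0) -> exists2 M : R, 0 <= M & forall x, `|psi x| <= M.
Proof.
move=> cpsi /(@compact_near_coveringP G) cK psi0.
have : \forall M \near +oo, K `<=` [set x | `|psi x| <= M].
  apply: (cK _ _ (fun M x => `|psi x| <= M)) => x Kx.
  exists ([set y | `|psi x - psi y| < 1], [set M | `|psi x| + 1 <= M]).
    split=> /=; last exact: nbhs_pinfty_ge.
    exact: (@cvgr_dist_lt _ _ _ _ _ psi _ (cpsi x)).
  move=> [y M] [/= xy]; apply: le_trans.
  rewrite -[psi y](subrK (psi x)) addrC (le_trans (ler_normD _ _))// lerD2l.
  by rewrite distrC ltW.
move=> KM; have [M [M0 {}KM]] : exists M, 0 <= M /\ K `<=` [set x | `|psi x| <= M].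
  apply: (@filter_ex _ +oo%R); near=> M; split; near: M => //.
  exact: nbhs_pinfty_ge.
exists M => // x; have [/KM//|/psi0 ->] := pselect (K x).
by rewrite normr0.
Unshelve. all: by end_near. Qed.

(** Compactness gives one neighbourhood of 0 valid for all base points in [K]; making it symmetric
    extends the estimate to base points outside [K]. *)
Lemma csupp_unif_continuous psi K : continuous psi -> compact K ->
    (forall x, ~ K x -> psi x = 0) -> forall e : R, 0 < e ->
  nbhs (0 : G) [set u | forall x, `|psi (x + u) - psi x| < e].
Proof.
move=> cpsi /(@compact_near_coveringP G) cK psi0 e e0.
have e20 : 0 < e / 2 by rewrite divr_gt0.
have KE : \forall u \near (0 : G), K `<=` [set x | `|psi (x + u) - psi x| < e].
  apply: (cK _ _ (fun u x => `|psi (x + u) - psi x| < e)) => x Kx.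
  have nx := @cvgr_dist_lt _ _ _ _ _ psi _ (cpsi x) _ e20.
  have := @add_continuous G (x, 0) [set z | `|psi x - psi z| < e / 2].
  rewrite /= addr0 => /(_ (nx _))[[A B] /= [xA B0] AB].
  exists (A `&` [set y | `|psi x - psi y| < e / 2], B).
    by split => //=; apply: filterI => //; exact: nx.
  move=> [y u] [/= [Ay xy] Bu].
  have := AB (y, u) (conj Ay Bu); rewrite /= distrC => xyu.
  rewrite -(subrKA (psi x)) (le_lt_trans (ler_normD _ _))//.
  by rewrite [e]splitr ltrD.
have [N [oN N0 NE Nsym]] := nbhs0_sym KE.
apply: (@filterS _ _ _ N); last exact: open_nbhs_nbhs.
move=> u Nu x; have [Kx|nKx] := pselect (K x); first exact: NE.
(* When only [x + u] lies in [K], the estimate is used at [x + u] with increment [- u]. *)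
have [Kxu|nKxu] := pselect (K (x + u)); last by rewrite !psi0// subrr normr0.
by have := NE _ (Nsym _ Nu) _ Kxu; rewrite /= addrK distrC.
Qed.

End continuous_compact_support.

(** * Comparison of integrals, and upper limits *)

Section integral_limsup.
Local Open Scope ereal_scope.

(** The integral of a nonnegative function is a supremum over the simple functions below it, and a
    larger function has more of these. This serves for the Besicovitch integrand, whose
    measurability is not established. *)
Lemma le_integral_nonmeasurable d (T : measurableType d) (R : realType)
    (mu : {measure set T -> \bar R}) (D : set T) (f g : T -> \bar R) :
  (forall x, D x -> 0 <= f x) -> (forall x, D x -> f x <= g x) ->
  \int[mu]_(x in D) f x <= \int[mu]_(x in D) g x.
Proof.
move=> f0 fg.
have g0 x : D x -> 0 <= g x by move=> Dx; rewrite (le_trans (f0 x Dx)) ?fg.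
rewrite !ge0_integralE//; apply: le_ereal_sup => _ [h hf <-]; exists h => // x.
apply: (le_trans (hf x)); rewrite /patch; case: ifPn => // xD.
by apply: fg; rewrite inE in xD.
Qed.

(** The upper limit is an infimum of suprema over tails, so one tail has its supremum below [x];
    that supremum is [y]. *)
Lemma limn_esup_lt (R : realType) (u : (\bar R)^nat) x : limn_esup u < x ->
  exists2 y, y < x & \forall n \near \oo, u n <= y.
Proof.
move=> /ereal_inf_lt[_ [V Voo <-] ux]; exists (ereal_sup (u @` V)) => //.
by apply: filterS Voo => n Vn; apply: ereal_sup_ubound; exists n.
Qed.

Lemma limn_esup_le (R : realType) (u : (\bar R)^nat) y :
  (\forall n \near \oo, u n <= y) -> limn_esup u <= y.
Proof.
move=> uy; apply: (@le_trans _ _ (ereal_sup (u @` [set n | u n <= y]))).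
  by apply: ereal_inf_lbound; exists [set n | u n <= y].
by apply: ge_ereal_sup => _ [n uny <-].
Qed.

End integral_limsup.

(** * Convolution with a Dirac comb as a locally finite sum *)

Section convolution.
Variables (R : realType) (G : topologicalZmodType).
Implicit Types (psi : G -> R) (B K L : set G) (s t x : G).

(** The nonzero terms come from [s - K]. Finiteness has to be recorded because [\sum_(x \in L)] is 0
    by convention when infinitely many terms are nonzero. *)
Lemma finite_support_sub L psi K s : locally_finite L -> compact K ->
    (forall x, ~ K x -> psi x = 0) ->
  finite_set (L `&` (fun x => psi (s - x)) @^-1` [set~ 0]).
Proof.
move=> fL cK psi0; apply: sub_finite_set (fL _ (@compact_subl _ 0 _ cK) s).
move=> x [Lx /= psix]; split => //; rewrite translateE.
exists (s - x); last by rewrite sub0r opprB.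
by apply: contrapT => /psi0.
Qed.

Lemma fsumID L B (f : G -> R) : finite_set (L `&` f @^-1` [set~ 0]) ->
  \sum_(x \in L) f x = \sum_(x \in L `&` B) f x + \sum_(x \in L `\` B) f x.
Proof.
move=> fin; rewrite fsbig_supp (fsbigID B)//= [X in _ = X + _]fsbig_supp.
by rewrite [X in _ = _ + X]fsbig_supp setIAC setDE [L `&` ~` B `&` _]setIAC.
Qed.

(** Translating the convolution by [t] amounts to replacing the comb of [L] by that of [t + L]. *)
Lemma fsum_translate L t (f : G -> R) s :
  \sum_(x \in L) f (s - t - x) = \sum_(x \in translate t L) f (s - x).
Proof.
rewrite [RHS](@reindex_fsbig _ _ _ _ _ (fun x => t + x) L).
  by apply: eq_fsbigr => x _; rewrite opprD addrA.
split=> [x Lx|x y _ _ /addrI//|_ [x Lx <-]]; first by exists x.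
by exists x.
Qed.

Lemma Rintegral_dirac_comb_sub L psi K t : hausdorff_space G -> locally_finite L ->
    continuous psi -> compact K -> (forall x, ~ K x -> psi x = 0) ->
  \int[dirac_comb L]_s psi (t - s) = \sum_(x \in L) psi (t - x).
Proof.
move=> hG fL cpsi cK psi0.
have cK' := @compact_subl _ 0 _ cK.
apply: (@Rintegral_dirac_comb R G L (translate t [set 0 - x | x in K])).
- by apply: compact_borel => //; exact: compact_translate.
- exact: fL.
- apply: continuous_borel => x; apply: (@continuous_comp _ _ _ (fun s => t - s) psi).
    exact: subl_continuous.
  exact: cpsi.
- move=> x nDx; apply: psi0 => Kx; apply: nDx; rewrite translateE.
  by exists (t - x) => //; rewrite sub0r opprB.
Qed.

Lemma continuous_csupp_Re (phi : G -> R[i]) :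
  continuous_csupp phi -> continuous (fun x => complex.Re (phi x)).
Proof.
move=> [cphi _] x.
apply: (@continuous_comp _ _ _ (phi : G -> R[i]^o) (@complex.Re R : R[i]^o -> R)).
  exact: cphi.
exact: complex_Re_continuous.
Qed.

Lemma continuous_csupp_Im (phi : G -> R[i]) :
  continuous_csupp phi -> continuous (fun x => complex.Im (phi x)).
Proof.
move=> [cphi _] x.
apply: (@continuous_comp _ _ _ (phi : G -> R[i]^o) (@complex.Im R : R[i]^o -> R)).
  exact: cphi.
exact: complex_Im_continuous.
Qed.

Lemma convolution_dirac_comb L (phi : G -> R[i]) t :
  hausdorff_space G -> locally_finite L -> continuous_csupp phi ->
  convolution (dirac_comb L) phi t =
  Complex (\sum_(x \in L) complex.Re (phi (t - x)))
          (\sum_(x \in L) complex.Im (phi (t - x))).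
Proof.
move=> hG fL cphi; rewrite /convolution; have [_ cK] := cphi.
have phi0 x := @notin_closure_support _ _ phi x.
congr Complex.
- apply: (@Rintegral_dirac_comb_sub L (fun x => complex.Re (phi x)) _ t hG fL _ cK).
    exact: continuous_csupp_Re.
  by move=> x /phi0 ->.
- apply: (@Rintegral_dirac_comb_sub L (fun x => complex.Im (phi x)) _ t hG fL _ cK).
    exact: continuous_csupp_Im.
  by move=> x /phi0 ->.
Qed.

Lemma fsum_ge_term L (f : G -> R) x : finite_set (L `&` f @^-1` [set~ 0]) ->
  (forall y, 0 <= f y) -> L x -> f x <= \sum_(y \in L) f y.
Proof.
move=> fin f0 Lx; rewrite fsbig_supp.
have [->|fx0] := eqVneq (f x) 0; first by apply: fsumr_ge0 => y _.
rewrite (fsbigD1 x)//; last by split => //; exact/eqP.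
by rewrite lerDl; apply: fsumr_ge0 => y _.
Qed.

End convolution.

(** * Bump functions *)

Section bump.
Variables (R : realType) (G : topologicalZmodType).

(** Complete regularity separates 0 from the complement of [U'] by some [f] with values in [0, 1],
    and [2 * (1 - f)] is taken. The factor 2 makes the value at 0 exceed 1, so that the set where
    the function exceeds 1 is a neighbourhood of 0. *)
Lemma bump_function (U : set G) : hausdorff_space G -> locally_compact [set: G] ->
    open U -> U 0 ->
  exists psi : G -> R, [/\ continuous psi, forall x, 0 <= psi x, 1 < psi 0,
    forall x, psi x != 0 -> U x & compact (closure [set x | psi x != 0])].
Proof.
move=> hG lG oU U0; have [C cC C0] := compact_nbhs0 lG.
pose U' := U `&` interior C.
have oU' : open U' by apply: openI => //; exact: open_interior.
have nU'0 : ~ (~` U') (0 : G) by move=> /(_ (conj U0 C0)).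
have := @locally_compact_completely_regular G R lG hG 0 _ (open_closedC oU') nU'0.
move=> /uniform_separatorP => /(_ R)[f [cf f01 f0 f1]].
have psi1 x : 1 - f x != 0 -> U' x.
  move=> fx; apply: contrapT => nU'x; move: fx.
  by rewrite (f1 (f x)) ?subrr ?eqxx//; exists x.
have psi2 x : 2 * (1 - f x) != 0 -> U' x.
  by rewrite mulf_eq0 negb_or => /andP[_]; exact: psi1.
exists (fun x => 2 * (1 - f x)); split.
- by move=> x; apply: cvgM; [exact: cvg_cst|apply: cvgB; [exact: cvg_cst|exact: cf]].
- move=> x; rewrite mulr_ge0// subr_ge0.
  have /= := f01 (f x) (ex_intro2 _ _ x Logic.I erefl).
  by rewrite in_itv/= => /andP[].
- by rewrite (f0 (f 0)) ?subr0 ?mulr1 ?ltr1n//; exists 0.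
- by move=> x /psi2[].
- apply: (subclosed_compact _ cC); first exact: closed_closure.
  rewrite [X in _ `<=` X](closure_id C).1; last exact: compact_closed.
  by apply: closureS => x /psi2[_ /interior_subset].
Qed.

End bump.

(** * Separation properties of the [U]-symmetric difference *)

Section symdiff.
Variables (G : topologicalZmodType) (U W : set G).
Hypothesis WU : forall x y, W x -> W y -> U (x - y).
Implicit Types (L M : set G).

(** Otherwise [x - y = (s - y) - (s - x)] would lie in [U], placing [x] in [M + U]. *)
Lemma symdiff_far L M x y s : (L `\` minkowski_add M U) x -> M y ->
  W (s - x) -> W (s - y) -> False.
Proof.
move=> [_ nMx] My Wx Wy; apply: nMx; apply/minkowski_addE; exists y => //.
by have := WU Wy Wx; rewrite opprB addrC addrA subrK.
Qed.

(** Two points from the same set are separated by hypothesis, two points from different sets by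
    [symdiff_far]. *)
Lemma disjoint_translates_symdiff L M : disjoint_translates W L ->
  disjoint_translates W M -> disjoint_translates W (symdiff U L M).
Proof.
move=> dL dM x y Sx Sy xy; have [z []] := xy; rewrite !translateE => Wx Wy.
have [[Lx|Mx] [Ly|My]] := (Sx, Sy).
- exact: dL Lx.1 Ly.1 xy.
- by have := symdiff_far Lx My.1 Wx Wy.
- by have := symdiff_far Ly Mx.1 Wy Wx.
- exact: dM Mx.1 My.1 xy.
Qed.

End symdiff.

(** * Van Hove sequences *)

Section van_hove.
Variables (R : realType) (G : topologicalZmodType).
Variables (theta : {measure set (borel G) -> \bar R}) (A : nat -> set G).
Hypothesis hausdorffG : hausdorff_space G.
Hypothesis haar : haar_measure theta.
Hypothesis vanHoveA : van_hove theta A.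
Local Open Scope ereal_scope.

Lemma van_hove_fin n : exists2 a : R, (0 < a)%R & theta (A n) = a%:E.
Proof.
have cA : compact (closure (A n)).
  by rewrite -precompactE; exact: (van_hove_precompact vanHoveA).
have Afin : theta (A n) \is a fin_num.
  rewrite ge0_fin_numE ?measure_ge0// (le_lt_trans _ (haar_compact haar cA))//.
  apply: haar_le; [|exact: compact_borel|].
    by apply: open_borel; exact: (van_hove_open vanHoveA).
  exact: subset_closure.
exists (fine (theta (A n))); last by rewrite fineK.
by rewrite -lte_fin fineK//; exact: (van_hove_gt0 vanHoveA).
Qed.

Lemma div_van_hove_le n (x : \bar R) (y : R) :
  (x / theta (A n) <= y%:E) = (x <= y%:E * theta (A n)).
Proof.
by have [a a0 ->] := van_hove_fin n; rewrite inver gt_eqF// lee_pdivrMr.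
Qed.

Lemma van_hove_boundary_small K (d : R) : compact K -> (0 < d)%R ->
  \forall n \near \oo, theta (boundary K (A n)) <= d%:E * theta (A n).
Proof.
move=> cK d0; have /cvg_limn_einf_sup[_ supE] := van_hove_boundary vanHoveA cK.
have /limn_esup_lt[y yd] :
    limn_esup (fun n => theta (boundary K (A n)) / theta (A n)) < d%:E.
  by rewrite supE lte_fin.
by apply: filterS => n yn; rewrite -div_van_hove_le (le_trans yn)// ltW.
Qed.

End van_hove.

(** * From mean almost periodicity to small symmetric differences *)

Section mean_almost_periodic_symdiff.
Variables (R : realType) (G : topologicalZmodType).
Variables (theta : {measure set (borel G) -> \bar R}) (A : nat -> set G).
Hypothesis hausdorffG : hausdorff_space G.
Hypothesis lcG : locally_compact [set: G].
Hypothesis haar : haar_measure theta.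
Hypothesis vanHoveA : van_hove theta A.
Implicit Types (L : set G) (psi : G -> R).

(** The left side is at most the measure of [(S]&[B) + W]. Inside [B] this set is charged to the
    integral, as [f] is at least 1 on it; what sticks out of [B] lies in [B + C] but not in [B],
    hence in the boundary. *)
Lemma packing_boundary (W C S B : set G) (f : G -> R) :
    open W -> (0 < theta W)%E -> W `<=` C -> disjoint_translates W S -> open B ->
    (forall x, 0 <= f x) ->
    (forall z x, S z -> W (x - z) -> 1 <= f x) ->
  (counting (S `&` B) * theta W <=
     \int[theta]_(x in B) (f x)%:E + theta (boundary C B))%E.
Proof.
move=> oW W0 WC dS oB f0 f1; pose SW := minkowski_add (S `&` B) W.
have oSW : open SW by exact: open_minkowski_addr.
have mSW := open_borel oSW; have mB := open_borel oB.
apply: (@le_trans _ _ (theta SW)).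
  apply: haar_packing => //; apply: disjoint_translates_sub dS; exact: subIsetl.
have mSWB := measurableI _ _ mSW mB; have mSWnB := measurableD mSW mB.
have -> : theta SW = (theta (SW `&` B) + theta (SW `\` B))%E.
  by rewrite addeC; exact: measureDI.
apply: leeD.
  apply: (@le_trans _ _ (\int[theta]_(x in B `&` SW) 1)%E).
    by rewrite setIC integral_cst ?mul1e//; exact: measurableI.
  rewrite integral_mkcondr; apply: le_integral_nonmeasurable => x Bx.
    by rewrite /patch; case: ifPn; rewrite ?lee_fin.
  rewrite /patch; case: ifPn; rewrite ?lee_fin// inE.
  by move=> /minkowski_addE[z [Sz _] Wxz]; exact: f1 Sz Wxz.
apply: haar_le => //; first by apply: closed_borel; exact: closed_boundary.
move=> x [[z [Sz Bz] [w Ww <-]] nB]; left; split; last exact: subset_closure.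
by apply: subset_closure; exists z => //; exists w => //; exact: WC.
Qed.

Lemma mean_almost_periodic_symdiff L : delone L ->
  mean_almost_periodic theta A (dirac_comb L) ->
  forall U : set G, open U -> U 0 -> forall e : R, 0 < e ->
  relatively_dense [set t : G | (limn_esup (fun n =>
     counting (symdiff U L (translate t L) `&` A n) / theta (A n)) < e%:E)%E].
Proof.
move=> [_ /uniformly_discreteP[V [oV V0 dV]]] [_ mapL] U oU U0 e e0.
(* Differences of points of [W0] have to lie in [U], to keep bumps at far points away from the other
   set, and in [V], to keep the translates of [W] disjoint. *)
have UV0 : nbhs (0 : G) (U `&` V) by apply: open_nbhs_nbhs; split; [exact: openI|].
have [W0 [oW0 W00 W0U]] := nbhs0_sub UV0.
have [C cC C0] := compact_nbhs0 lcG.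
pose U' := W0 `&` interior C.
have oU' : open U' by apply: openI => //; exact: open_interior.
have U'0 : U' 0 by split.
have U'U x y : U' x -> U' y -> U (x - y) by move=> [? _] [? _]; have [] := W0U x y.
have [psi [cpsi psi_ge0 psi0 psiU' cspsi]] := bump_function R hausdorffG lcG oU' U'0.
pose W := [set x | 1 < psi x].
have oW : open W.
  rewrite (_ : W = psi @^-1` [set y | 1 < y])//.
  by move/continuousP : cpsi; apply; exact: open_gt.
have WU' : W `<=` U'.
  by move=> x Wx; apply: psiU'; rewrite gt_eqF// (lt_trans _ Wx).
have WV : W `<=` V.
  by move=> x /WU'[W0x _]; have := W0U x 0 W0x W00; rewrite subr0 => -[].
have tW0 : (0 < theta W)%E.
  by apply: haar_open_gt0 => //.
have tWfin : theta W \is a fin_num.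
  rewrite ge0_fin_numE ?measure_ge0// (le_lt_trans _ (haar_compact haar cC))//.
  apply: haar_le; [exact: open_borel|exact: compact_borel|].
  by move=> x /WU'[_ /interior_subset].
pose w := fine (theta W).
have w0 : 0 < w by rewrite -lte_fin fineK.
have lfL := disjoint_translates_locally_finite haar hausdorffG lcG oV V0 dV.
pose phi x := (psi x)%:C%C.
have cphi : continuous_csupp phi.
  split.
    move=> x; apply: (@continuous_comp _ _ _ psi (real_complex R : R -> R[i]^o)).
      exact: cpsi.
    exact: real_complex_continuous.
  rewrite (_ : [set x | phi x != 0] = [set x | psi x != 0])//.
  by apply/seteqP; split=> x /=; rewrite /phi fmorph_eq0.
(* The integral and the boundary term will each be at most [d * a], where [a] is the measure of
   [A n]; division by [w] leaves [e / 2 * a]. *)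
pose d := e * w / 4.
have d0 : 0 < d by rewrite divr_gt0// mulr_gt0.
apply: relatively_denseS (mapL phi cphi d d0) => t /=.
set D := fun s => (_ - _) => Dd.
pose S := symdiff U L (translate t L).
have dWL := disjoint_translatesS WV dV.
have dtWL : disjoint_translates W (translate t L).
  exact: disjoint_translates_translate.
have lftL : locally_finite (translate t L) by exact: locally_finite_translate.
have DE s : D s = (\sum_(x \in L) psi (s - x) -
                   \sum_(x \in translate t L) psi (s - x))%:C%C.
  rewrite /D !convolution_dirac_comb// -(fsum_translate L t psi) rmorphB/=.
  congr (_ - _); apply/eqP; rewrite eq_complex/= eqxx/=; apply/eqP; exact: fsbig1.
have big M z s : locally_finite M -> M z -> W (s - z) ->
    1 < \sum_(x \in M) psi (s - x).
  move=> lfM Mz Wz; apply: (lt_le_trans Wz).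
  apply: (@fsum_ge_term _ _ M (fun x => psi (s - x))) => //.
  apply: (@finite_support_sub _ _ _ _ _ s lfM cspsi) => x.
  exact: notin_closure_support.
(* Near a far point [z] of one set, the sum over the other set vanishes, while by [big] the sum over
   its own set exceeds 1; hence the lower bound [D1]. *)
have small M M' z s : (M `\` minkowski_add M' U) z -> W (s - z) ->
    \sum_(x \in M') psi (s - x) = 0.
  move=> Mz Wz; apply: fsbig1 => x M'x.
  apply/eqP; apply: contrapT => /negP /psiU' U'x.
  exact: symdiff_far U'U _ _ _ _ _ Mz M'x (WU' _ Wz) U'x.
have D1 z s : S z -> W (s - z) -> 1 <= ComplexField.Normc.normc (D s).
  move=> Sz Wz; rewrite DE /= expr0n addr0 sqrtr_sqr.
  case: Sz => Sz; rewrite (small _ _ _ _ Sz Wz).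
    have := big L z s lfL Sz.1 Wz; rewrite subr0 => b.
    by rewrite ger0_norm; lra.
  have := big _ z s lftL Sz.1 Wz; rewrite sub0r normrN => b.
  by rewrite ger0_norm; lra.
have [y yd Dy] := limn_esup_lt Dd.
have dS : disjoint_translates W S.
  by apply: disjoint_translates_symdiff => // x z Wx Wz; apply: U'U; exact: WU'.
apply: (@le_lt_trans _ _ (e / 2)%:E); last by rewrite lte_fin; lra.
apply: limn_esup_le; near=> n.
rewrite (div_van_hove_le hausdorffG haar vanHoveA).
have [a a0 An] := van_hove_fin hausdorffG haar vanHoveA n.
have -> : ((e / 2)%:E * theta (A n) = (d * a + d * a)%:E * w^-1%:E)%E.
  rewrite An -!EFinM; congr EFin; rewrite /d; field.
  by rewrite gt_eqF.
rewrite lee_pdivlMr// /w fineK// EFinD EFinM -An.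
have WC : W `<=` C by move=> x /WU'[_ /interior_subset].
have D0 s : 0 <= ComplexField.Normc.normc (D s).
  by rewrite DE /= sqrtr_ge0.
apply: (le_trans (packing_boundary oW tW0 WC dS (van_hove_open vanHoveA n) D0 D1)).
apply: leeD; last by near: n; exact: van_hove_boundary_small.
rewrite -(div_van_hove_le hausdorffG haar vanHoveA) (le_trans _ (ltW yd))//.
by near: n.
Unshelve. all: by end_near. Qed.

End mean_almost_periodic_symdiff.

(** * Pointwise bounds for the difference of two sums over point sets *)

Section sums.
Variables (R : realType) (G : topologicalZmodType).
Implicit Types (L P F S T B K U V : set G) (psi : G -> R).

Lemma norm_fsum_le P F (f : G -> R) (c b : R) : 0 <= b ->
    (forall x, P x -> ~ F x -> f x = 0) -> (forall x, P x -> `|f x| <= b) ->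
    (counting (P `&` F) <= c%:E)%E ->
  `|\sum_(x \in P) f x| <= c * b.
Proof.
move=> b0 fF fb cPF; have fin := counting_fin cPF.
rewrite -(@fsbig_widen _ _ _ _ (P `&` F))//; last first.
  by move=> x [Px /= nPF]; apply: fF => // Fx; exact: nPF.
rewrite fsbig_finite// (le_trans (ler_norm_sum _ _ _))//.
move: cPF; rewrite counting_fset// lee_fin => cPF.
apply: (@le_trans _ _ (\sum_(x <- fset_set (P `&` F)) b)).
  rewrite big_seq [leRHS]big_seq; apply: ler_sum => x.
  by rewrite in_fset_set// inE => -[Px _]; exact: fb.
by rewrite big_const_seq count_predT iter_addr_0 -mulr_natl ler_wpM2r.
Qed.

(** Each [x] is sent to a point of [L'] within [U] of it. Two points with the same image would have
    [V]-translates meeting there, and two points of [L'] close to the same [x] coincide for the same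
    reason; this gives injectivity and surjectivity. *)
Lemma near_matching L L' U V : (forall x, U x -> U (- x)) -> U `<=` V ->
    disjoint_translates V L -> disjoint_translates V L' ->
  exists h : G -> G,
    set_bij (L `&` minkowski_add L' U) (L' `&` minkowski_add L U) h /\
    forall x, minkowski_add L' U x -> U (x - h x).
Proof.
move=> symU UV dL dL'.
(* The default 0 is taken only at points outside [L' + U], where nothing is claimed about [h]. *)
pose h x := xget (0 : G) [set y | L' y /\ U (x - y)].
have hP x : minkowski_add L' U x -> L' (h x) /\ U (x - h x).
  move=> /minkowski_addE[y L'y Uxy].
  by apply: (@xgetPex _ 0 [set y | L' y /\ U (x - y)]); exists y.
have symUB x y : U (x - y) -> U (y - x) by move=> /symU; rewrite opprB.
exists h; split; last by move=> x /hP[].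
split.
- move=> x [Lx /hP[L'hx Uxhx]]; split => //.
  by apply/minkowski_addE; exists x => //; exact: symUB.
- move=> x y; rewrite !inE => -[Lx /hP[_ Ux]] [Ly /hP[_ Uy]] hxy.
  apply: dL => //; exists (h x); rewrite /= !translateE;
    split; apply: UV; apply: symUB => //.
  by rewrite hxy.
- move=> y [L'y /minkowski_addE[x Lx Uyx]].
  have L'Ux : minkowski_add L' U x.
    by apply/minkowski_addE; exists y => //; exact: symUB.
  exists x => //; have [L'hx Uxhx] := hP _ L'Ux.
  apply: dL' => //; exists x; rewrite /= !translateE; split; apply: UV => //.
  exact: symUB.
Qed.

(** The far parts are kept as they are and the near parts are paired by [near_matching], each pair
    differing by at most [eta]. The window [F] holds every [x] for which [x] or its partner
    contributes at [s], so at most [c] pairs count. *)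
Lemma fsum_diff_le L L' U V K F psi s (c eta : R) :
    (forall x, U x -> U (- x)) -> U `<=` V ->
    disjoint_translates V L -> disjoint_translates V L' ->
    (forall x, ~ K x -> psi x = 0) -> 0 <= eta ->
    (forall u x, U u -> `|psi (x + u) - psi x| <= eta) ->
    (forall x, K (s - x) -> F x) -> (forall x u, U u -> K (s - x + u) -> F x) ->
    (forall M, disjoint_translates V M -> (counting (M `&` F) <= c%:E)%E) ->
  `|\sum_(x \in L) psi (s - x) - \sum_(y \in L') psi (s - y)| <=
  `|\sum_(x \in L `\` minkowski_add L' U) psi (s - x)| +
  `|\sum_(y \in L' `\` minkowski_add L U) psi (s - y)| + c * eta.
Proof.
move=> symU UV dL dL' psi0 eta0 psiU KF KUF cF.
have fins M : disjoint_translates V M ->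
    finite_set (M `&` (fun x => psi (s - x)) @^-1` [set~ 0]).
  move=> /cF/counting_fin; apply: sub_finite_set => x [Mx /= psix]; split => //.
  by apply: KF; apply: contrapT => /psi0.
rewrite (fsumID (minkowski_add L' U) (fins L dL)).
rewrite (fsumID (minkowski_add L U) (fins L' dL')).
have [h [hbij hU]] := near_matching symU UV dL dL'.
rewrite [X in _ - (X + _)](reindex_fsbig _ _ _ _ hbij).
set P := L `&` minkowski_add L' U.
have dP : disjoint_translates V P.
  exact: (disjoint_translates_sub (@subIsetl _ _ _) dL).
have finPF := counting_fin (cF P dP).
have hE x : P x -> psi (s - h x) = psi (s - x + (x - h x)) by rewrite addrA subrK.
have PE : \sum_(x \in P) psi (s - x) - \sum_(x \in P) psi (s - h x) =
          \sum_(x \in P `&` F) (psi (s - x) - psi (s - h x)).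
  rewrite -(@fsbig_widen _ _ _ _ (P `&` F) P)//; last first.
    by move=> x [Px /= nF]; apply: psi0 => /KF Fx; exact: nF.
  rewrite -[X in _ - X](@fsbig_widen _ _ _ _ (P `&` F) P)//; last first.
    move=> x [Px /= nF]; rewrite hE//; apply: psi0 => /KUF Fx; apply: nF; split => //.
    by apply: Fx; exact: hU Px.2.
  by rewrite !fsbig_finite// sumrB.
have PF : `|\sum_(x \in P `&` F) (psi (s - x) - psi (s - h x))| <= c * eta.
  apply: (@norm_fsum_le _ F) => //; last by rewrite -setIA setIid; exact: cF.
    by move=> x [].
  by move=> x [Px _]; rewrite hE// distrC psiU//; exact: hU Px.2.
rewrite -PE in PF; move: PF.
set a := \sum_(x \in P) _; set b := \sum_(x \in P) _.
set a' := \sum_(x \in _) _; set b' := \sum_(x \in _) _ => ab.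
rewrite opprD addrACA (le_trans (ler_normD _ _))// [leRHS]addrC lerD//.
exact: ler_normB.
Qed.

(** Points of [T] in [B] contribute at most [M] each, and only on [z + K]; those outside [B]
    contribute only if [s] is a boundary point, and then at most [c] of them do. Summing over [S]
    lets one bound serve both halves of the symmetric difference. *)
Lemma fsum_far_le T S B K F psi s (c M : R) : T `<=` S -> finite_set (S `&` B) ->
    B s -> 0 <= M -> (forall x, `|psi x| <= M) -> (forall x, ~ K x -> psi x = 0) ->
    (forall x, K (s - x) -> F x) -> (counting (T `&` F) <= c%:E)%E ->
  `|\sum_(x \in T) psi (s - x)| <=
  \sum_(z <- fset_set (S `&` B)) M * \1_(translate z K) s +
  c * M * \1_(boundary [set 0 - k | k in K] B) s.
Proof.
move=> TS finSB Bs M0 psiM psi0 KF cTF.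
have finT : finite_set (T `&` (fun x => psi (s - x)) @^-1` [set~ 0]).
  apply: sub_finite_set (counting_fin cTF) => x [Tx /= psix]; split => //.
  by apply: KF; apply: contrapT => /psi0.
rewrite (fsumID B finT) (le_trans (ler_normD _ _))// lerD//.
  have finTB : finite_set (T `&` B) by apply: sub_finite_set finSB; exact: setSI.
  rewrite -(fsbig_finite _ _ finSB) (fsbigID T)//=.
  have -> : S `&` B `&` T = T `&` B by rewrite setIC setIA (setIidl TS).
  rewrite -[leLHS]addr0 lerD//; last first.
    by apply: fsumr_ge0 => x _; rewrite mulr_ge0.
  rewrite !fsbig_finite// (le_trans (ler_norm_sum _ _ _))//.
  apply: ler_sum => x _; rewrite indicE; case: (boolP (s \in translate x K)) => sK.
    by rewrite mulr1.
  by rewrite mulr0 psi0 ?normr0// => Ksx; move/negP: sK; rewrite inE translateE.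
rewrite indicE; case: (boolP (s \in boundary _ _)) => sB.
  rewrite mulr1; apply: (@norm_fsum_le _ F) => //.
    by move=> x _ nF; apply: psi0 => /KF.
  have finTF := counting_fin cTF.
  have sTF : (T `\` B) `&` F `<=` T `&` F by apply: setSI; exact: subDsetl.
  have finTBF := sub_finite_set sTF finTF.
  apply: (le_trans _ cTF); rewrite !counting_fset// lee_fin ler_nat.
  by rewrite fsubset_leq_card// -fset_set_sub.
rewrite mulr0 fsbig1 ?normr0// => z [Tz nBz]; apply: psi0 => Ksz.
(* Here [z] is outside [B] and [s = z - (0 - (s - z))] is in [B], which is the second half of the
   boundary for the reflected set [- K]. *)
move/negP : sB; apply; rewrite inE; right; split; last exact: subset_closure.
apply: subset_closure; exists z => //; exists (0 - (s - z)); first by exists (s - z).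
by rewrite sub0r opprK addrC subrK.
Qed.

End sums.

(** * Integrals of sums of indicators *)

Section integral_indic_le.
Local Open Scope ereal_scope.
Context d (T : measurableType d) (R : realType).
Variables (mu : {measure set T -> \bar R}) (D : set T).
Hypothesis mD : measurable D.

Lemma integral_indic_le (E : set T) (r : R) : measurable E -> (0 <= r)%R ->
  \int[mu]_(x in D) (r * \1_E x)%:E <= r%:E * mu E.
Proof.
move=> mE r0; under eq_integral do rewrite EFinM.
rewrite ge0_integralZl_EFin//; last exact/measurable_EFinP/measurable_indic.
rewrite lee_wpmul2l ?lee_fin// integral_indic//.
by apply: le_measure; rewrite ?inE//; exact: measurableI.
Qed.

(** Meant for translates [E i] of one compact set, which share the Haar measure [k], for a boundary
    [E'], and for a constant uniform-continuity error [r'']. *)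
Lemma integral_sum_indic_le (I : Type) (X : seq I) (E : I -> set T) (E' : set T)
    (r r' r'' k : R) :
    (forall i, measurable (E i)) -> (forall i, mu (E i) = k%:E) -> measurable E' ->
    (0 <= r)%R -> (0 <= r')%R -> (0 <= r'')%R ->
  \int[mu]_(x in D) (\sum_(i <- X) r * \1_(E i) x + r' * \1_E' x + r'')%:E <=
  ((size X)%:R * (r * k))%:E + r'%:E * mu E' + r''%:E * mu D.
Proof.
move=> mE Ek mE' r0 r'0 r''0.
have mI F s : measurable F -> measurable_fun D (fun x : T => (s * \1_F x)%:E).
  by move=> mF; apply/measurable_EFinP/measurable_funM => //; exact: measurable_indic.
have mS : measurable_fun D (fun x : T => \sum_(i <- X) (r * \1_(E i) x)%:E).
  by apply: emeasurable_sum => i; exact: mI.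
have I0 F s x : (0 <= s)%R -> 0 <= (s * \1_F x : R)%:E.
  by move=> s0; rewrite lee_fin mulr_ge0.
have S0 x : 0 <= \sum_(i <- X) (r * \1_(E i) x)%:E.
  by apply: sume_ge0 => i _; exact: I0.
under eq_integral do rewrite !EFinD -sumEFin.
rewrite ge0_integralD//; last 2 first.
- by move=> x _; rewrite adde_ge0// I0.
- by apply: emeasurable_funD => //; exact: mI.
rewrite ge0_integralD//; last 2 first.
- by move=> x _; exact: I0.
- exact: mI.
rewrite integral_cst//; apply: leeD => //.
apply: leeD; last exact: integral_indic_le.
rewrite ge0_integral_sum//; last 2 first.
- by move=> i; exact: mI.
- by move=> i x _; exact: I0.
apply: (@le_trans _ _ (\sum_(i <- X) (r * k)%:E)).
  by apply: lee_sum => i _; rewrite EFinM -(Ek i) integral_indic_le.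
by rewrite sumEFin lee_fin big_const_seq count_predT iter_addr_0 mulr_natl.
Qed.

End integral_indic_le.

(** The [+ 1] keeps the denominator positive when [r] is 0, so the coefficients [r] to come need no
    case distinction. *)
Lemma ler_mul_damped (R : realType) (r e : R) : 0 <= r -> 0 < e ->
  r * (e / (4 * (r + 1))) <= e / 4.
Proof.
move=> r0 e0.
have r1 : 0 < r + 1 by rewrite ltr_wpDl.
have -> : r * (e / (4 * (r + 1))) = r / (r + 1) * (e / 4) by field; rewrite gt_eqF.
by rewrite ler_piMl ?divr_ge0 ?ltW// ltr_pdivrMr// mul1r ltrDl.
Qed.

(** * From small symmetric differences to mean almost periodicity *)

Section symdiff_mean_almost_periodic.
Variables (R : realType) (G : topologicalZmodType).
Variables (theta : {measure set (borel G) -> \bar R}) (A : nat -> set G).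
Hypothesis hausdorffG : hausdorff_space G.
Hypothesis lcG : locally_compact [set: G].
Hypothesis haar : haar_measure theta.
Hypothesis vanHoveA : van_hove theta A.
Implicit Types (L : set G) (psi : G -> R).

Lemma translation_bounded_dirac_comb L : delone L ->
  translation_bounded (dirac_comb L : {measure set (borel G) -> \bar R}).
Proof.
move=> [_ /uniformly_discreteP[V [oV V0 dV]]] K cK.
have [c _ cP] := disjoint_translates_count_bound haar hausdorffG lcG oV V0 cK.
apply: (@le_lt_trans _ _ c%:E); last exact: ltry.
apply: ge_ereal_sup => _ [t _ <-].
rewrite (_ : _ (translate t K) = counting (L `&` translate t K)); first exact: cP.
by apply: dirac_comb_counting; exact: counting_fin (cP L t dV).
Qed.

Lemma convolution_dirac_comb_diff L (phi : G -> R[i]) s t : locally_finite L ->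
    continuous_csupp phi ->
  ComplexField.Normc.normc (convolution (dirac_comb L) phi s -
                            convolution (dirac_comb L) phi (s - t)) <=
  `|\sum_(x \in L) complex.Re (phi (s - x)) -
    \sum_(x \in translate t L) complex.Re (phi (s - x))| +
  `|\sum_(x \in L) complex.Im (phi (s - x)) -
    \sum_(x \in translate t L) complex.Im (phi (s - x))|.
Proof.
move=> fL cphi; rewrite !convolution_dirac_comb//.
rewrite -(fsum_translate L t (fun x => complex.Re (phi x))).
rewrite -(fsum_translate L t (fun x => complex.Im (phi x))).
exact: normc_ler_norm.
Qed.

Lemma symdiff_mean_almost_periodic L : delone L ->
  (forall U : set G, open U -> U 0 -> forall e : R, 0 < e ->
  relatively_dense [set t : G | (limn_esup (fun n =>
     counting (symdiff U L (translate t L) `&` A n) / theta (A n)) < e%:E)%E]) ->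
  mean_almost_periodic theta A (dirac_comb L).
Proof.
move=> dL denseL; split; first exact: translation_bounded_dirac_comb.
move: dL => [_ /uniformly_discreteP[V [oV V0 dV]]] phi cphi e e0.
have lfL := disjoint_translates_locally_finite haar hausdorffG lcG oV V0 dV.
have [_ cK] := cphi; set K := closure _ in cK.
pose psi1 x := complex.Re (phi x); pose psi2 x := complex.Im (phi x).
have phi0 x : ~ K x -> phi x = 0 by exact: notin_closure_support.
have psi10 x : ~ K x -> psi1 x = 0 by rewrite /psi1 => /phi0 ->.
have psi20 x : ~ K x -> psi2 x = 0 by rewrite /psi2 => /phi0 ->.
have cpsi1 : continuous psi1 by exact: continuous_csupp_Re.
have cpsi2 : continuous psi2 by exact: continuous_csupp_Im.
have [M1 M10 psi1M1] := csupp_bounded cpsi1 cK psi10.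
have [M2 M20 psi2M2] := csupp_bounded cpsi2 cK psi20.
pose M := M1 + M2; have M0 : 0 <= M by rewrite addr_ge0.
have psi1M x : `|psi1 x| <= M by rewrite (le_trans (psi1M1 x))// lerDl.
have psi2M x : `|psi2 x| <= M by rewrite (le_trans (psi2M2 x))// lerDr.
have [C cC C0] := compact_nbhs0 lcG.
(* [s + N] is the window for the sums at [s]: it contains [x] if [s - x] is in [K], and also if
   [s - x + u] is in [K] for some [u] in [U]. The summand [C] makes room for the second case. *)
pose N := [set 0 - k | k in minkowski_add K C].
have cN : compact N by apply: compact_subl; exact: compact_minkowski_add.
have [c c0 cP] := disjoint_translates_count_bound haar hausdorffG lcG oV V0 cN.
have Kfin : theta K \is a fin_num by rewrite ge0_fin_numE ?measure_ge0// haar_compact.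
pose k := fine (theta K); have k0 : 0 <= k by rewrite fine_ge0.
(* [eta], [e'] and [d] below each account for [e / 4] of the final bound. *)
pose eta := e / (4 * (2 * c + 1)).
have r10 : 0 <= 2 * c by rewrite mulr_ge0.
have r20 : 0 <= 4 * (c * M) by rewrite mulr_ge0// mulr_ge0.
have r30 : 0 <= 4 * M by rewrite mulr_ge0.
have r3k0 : 0 <= 4 * M * k by rewrite mulr_ge0.
have eta0 : 0 < eta by rewrite divr_gt0// mulr_gt0// ltr_wpDl.
have nV : nbhs (0 : G) V by exact: open_nbhs_nbhs.
(* [U] has to give variation at most [eta] for both components, lie in [V] for the matching, and lie
   in [C] for the window. *)
have nU := filterI (filterI (csupp_unif_continuous cpsi1 cK psi10 eta0)
  (csupp_unif_continuous cpsi2 cK psi20 eta0))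
  (filterI nV C0).
have [U [oU U0 UnU symU]] := nbhs0_sym (nU _ _ _).
have UV : U `<=` V by move=> u /UnU[_ []].
have UC : U `<=` C by move=> u /UnU[_ []].
have psi1U u x : U u -> `|psi1 (x + u) - psi1 x| <= eta.
  by move=> /UnU[[/(_ x)/ltW]].
have psi2U u x : U u -> `|psi2 (x + u) - psi2 x| <= eta.
  by move=> /UnU[[_ /(_ x)/ltW]].
pose e' := e / (4 * (4 * M * k + 1)).
have e'0 : 0 < e' by rewrite divr_gt0// mulr_gt0// ltr_wpDl.
apply: relatively_denseS (denseL U oU U0 e' e'0) => t /= /limn_esup_lt[y ye' Sy].
have KF s x : K (s - x) -> translate s N x.
  move=> Ksx; rewrite translateE; exists (s - x); last by rewrite sub0r opprB.
  by exists (s - x) => //; exists 0; [exact: nbhs_singleton|rewrite addr0].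
have KUF s x u : U u -> K (s - x + u) -> translate s N x.
  move=> Uu Ksxu; rewrite translateE; exists (s - x); last by rewrite sub0r opprB.
  by exists (s - x + u) => //; exists (- u); [exact/UC/symU|rewrite addrK].
pose tL := translate t L.
have dtV : disjoint_translates V tL by exact: disjoint_translates_translate.
pose T1 := L `\` minkowski_add tL U; pose T2 := tL `\` minkowski_add L U.
pose S := symdiff U L tL.
have T1S : T1 `<=` S by move=> x; left.
have T2S : T2 `<=` S by move=> x; right.
have T1c s : (counting (T1 `&` translate s N) <= c%:E)%E.
  by apply: cP; apply: disjoint_translates_sub dV; exact: subDsetl.
have T2c s : (counting (T2 `&` translate s N) <= c%:E)%E.
  by apply: cP; apply: disjoint_translates_sub dtV; exact: subDsetl.
pose bd n := boundary [set 0 - k | k in K] (A n).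
pose Q n s := \sum_(z <- fset_set (S `&` A n)) M * \1_(translate z K) s +
              c * M * \1_(bd n) s.
have diff psi n s : (forall x, ~ K x -> psi x = 0) -> (forall x, `|psi x| <= M) ->
    (forall u x, U u -> `|psi (x + u) - psi x| <= eta) ->
    finite_set (S `&` A n) -> A n s ->
    `|\sum_(x \in L) psi (s - x) - \sum_(x \in tL) psi (s - x)| <=
    Q n s + Q n s + c * eta.
  move=> psi0 psiM psiU finS As.
  apply: (le_trans (fsum_diff_le symU UV dV dtV psi0 (ltW eta0) psiU
    (KF s) (KUF s) (fun M dM => cP M s dM))).
  rewrite lerD2r lerD//.
    exact: (fsum_far_le T1S finS As M0 psiM psi0 (KF s) (T1c s)).
  exact: (fsum_far_le T2S finS As M0 psiM psi0 (KF s) (T2c s)).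
pose d := e / (4 * (4 * (c * M) + 1)).
have d0 : 0 < d by rewrite divr_gt0// mulr_gt0// ltr_wpDl.
apply: (@le_lt_trans _ _ (3 / 4 * e)%:E); last by rewrite lte_fin; lra.
apply: limn_esup_le; near=> n.
have [a a0 An] := van_hove_fin hausdorffG haar vanHoveA n.
rewrite (div_van_hove_le hausdorffG haar vanHoveA).
have Sn : (counting (S `&` A n) <= e'%:E * theta (A n))%E.
  rewrite -(div_van_hove_le hausdorffG haar vanHoveA) (le_trans _ (ltW ye'))//.
  by near: n.
have bdn : (theta (bd n) <= d%:E * theta (A n))%E.
  by near: n; apply: van_hove_boundary_small => //; exact: compact_subl.
rewrite An -EFinM in Sn bdn *.
have finS := counting_fin Sn; rewrite counting_fset// lee_fin in Sn.
have mAn : measurable (A n : set (borel G)).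
  by apply: open_borel; exact: (van_hove_open vanHoveA).
have mK : measurable (K : set (borel G)) by exact: compact_borel.
(* Two components and two halves of the symmetric difference give the factor 4; the matching error
   occurs once per component, hence the factor 2. *)
apply: (@le_trans _ _ (\int[theta]_(s in A n)
   (\sum_(z <- fset_set (S `&` A n)) 4 * M * \1_(translate z K) s +
    4 * (c * M) * \1_(bd n) s + 2 * c * eta)%:E)%E).
  apply: le_integral_nonmeasurable => s As; rewrite lee_fin.
    by case: (_ - _) => ? ?; rewrite sqrtr_ge0.
  apply: (le_trans (convolution_dirac_comb_diff _ _ lfL cphi)).
  apply: (le_trans (lerD (diff psi1 n s psi10 psi1M psi1U finS As)
                         (diff psi2 n s psi20 psi2M psi2U finS As))).
  rewrite -(eq_bigr _ (fun z _ => mulrA 4 M _)) -mulr_sumr /Q; lra.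
have mz z : measurable (translate z K : set (borel G)).
  by apply: compact_borel => //; exact: compact_translate.
have tz z : theta (translate z K) = k%:E by rewrite (haar_invariant haar)// /k fineK.
have mbd : measurable (bd n : set (borel G)).
  by apply: closed_borel; exact: closed_boundary.
apply: (le_trans (integral_sum_indic_le mAn _ mz tz mbd r30 r20 _)).
  by rewrite mulr_ge0// ltW.
apply: (@le_trans _ _ ((e' * a) * (4 * M * k) +
  4 * (c * M) * (d * a) + 2 * c * eta * a)%:E).
  rewrite An !EFinD; apply: leeD; last by rewrite -EFinM.
  apply: leeD; first by rewrite lee_fin ler_wpM2r.
  by rewrite (EFinM (4 * (c * M))); apply: lee_wpmul2l; rewrite ?lee_fin.
rewrite lee_fin.
have := ler_mul_damped r10 e0; have := ler_mul_damped r20 e0.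
have := ler_mul_damped r3k0 e0.
rewrite -/eta -/e' -/d => h1 h2 h3.
have -> : e' * a * (4 * M * k) + 4 * (c * M) * (d * a) + 2 * c * eta * a =
  (4 * M * k * e' + 4 * (c * M) * d + 2 * c * eta) * a by ring.
by rewrite ler_wpM2r ?(ltW a0)//; lra.
Unshelve. all: by end_near. Qed.

End symdiff_mean_almost_periodic.

Theorem theorem3p21 (R : realType) (G : topologicalZmodType)
    (hausdorffG : hausdorff_space G)
    (lcG : locally_compact [set: G])
    (scG : sigma_compact G)
    (theta : {measure set (borel G) -> \bar R})
    (haar : haar_measure theta)
    (A : nat -> set G) (vanHoveA : van_hove theta A)
    (L : set G) (deloneL : delone L) :
  mean_almost_periodic theta A (dirac_comb L) <->
  (forall U : set G, open U -> U 0 -> forall e : R, 0 < e ->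
     relatively_dense [set t : G |
       (limn_esup (fun n =>
          counting (symdiff U L (translate t L) `&` A n) / theta (A n))
        < e%:E)%E]).
Proof.
by split; [exact: mean_almost_periodic_symdiff|exact: symdiff_mean_almost_periodic].
Qed.
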